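(* Let $t$ be an ordinal tree with $n$ nodes, let $B\ge 1$, and let $\mathcal{C}$ be the tree cover of $t$ produced by the Farzan–Munro algorithm with parameter $B$. Construct $t'$ and the modified tree cover as described in the context. Then the modified tree cover satisfies: (1) the number of micro trees is $\mathrm{O}(n/B)$; (2) each micro tree either consists of a single node (with an arbitrary number of child micro trees), or consists of fewer than $2B$ nodes and has at most one child micro tree.
   Context: An ordinal tree is a rooted tree in which the children of each node are ordered. The Farzan–Munro tree-covering algorithm with parameter $B$ produces a collection of micro trees, each a connected set of nodes of $t$ (hence a subtree rooted at its topmost node, its root), covering all nodes, such that any two micro trees are disjoint or share only their common root; it is known that there are $\mathrm{O}(n/B)$ micro trees, each has fewer than $2B$ nodes, and each micro tree has at most one edge from one of its non-root nodes to a node outside it. Modified tree cover: for each micro tree $\mu$ of $\mathcal{C}$ with more than one node and root $v$, create a new dummy node $w$ as a child of $v$ and make the children of $v$ that lie in $\mu$ children of $w$ instead (keeping their order); let $t'$ be the resulting tree. The micro tree $\mu$ is replaced by two micro trees: the singleton $\{v\}$ and $\{w\}\cup(\mu\setminus\{v\})$ (rooted at $w$); single-node micro trees of $\mathcal{C}$ are kept (identical singletons are identified). A micro tree $\nu$ is a child micro tree of a micro tree $\mu$ if the parent in $t'$ of the root of $\nu$ lies in $\mu$. *)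

(* Defs.v *)
From HB Require Import structures.
From mathcomp Require Import all_boot.

Set Implicit Arguments.
Unset Strict Implicit.
Unset Printing Implicit Defensive.

(* [tree T] is raw data on the node set [T]; [ordinal_tree] says that the data
   is an ordinal tree whose nodes are exactly the elements of [T]. *)
Record tree (T : finType) := Tree { root : T; children : T -> seq T }.

Section Trees.
Variables (T : finType) (t : tree T).

Definition childrel : rel T := [rel x y | y \in children t x].

Record ordinal_tree : Prop := OrdinalTree {
  ot_uniq : forall v, uniq (children t v);
  ot_root : forall v, root t \notin children t v;
  ot_parent : forall u v w,
    w \in children t u -> w \in children t v -> u = v;
  ot_reach : forall v, connect childrel (root t) v }.

Definition edge : rel T := [rel x y | childrel x y || childrel y x].

Definition connected_nodes (mu : {set T}) : Prop :=
  mu != set0 /\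
  {in mu &, forall x y,
     connect [rel a b | [&& a \in mu, b \in mu & edge a b]] x y}.

(* The topmost node of [mu], i.e. the node of [mu] that is an ancestor of every
   node of [mu]; the default value is irrelevant for connected sets of nodes
   (see [micro_rootP]). *)
Definition micro_root (mu : {set T}) : T :=
  odflt (root t) [pick r in mu | [forall x in mu, connect childrel r x]].

(* The edges between a non-root node of [mu] and a node outside [mu], oriented
   outwards. *)
Definition leaving_edges (mu : {set T}) : {set T * T} :=
  [set e | [&& e.1 \in mu, e.1 != micro_root mu, e.2 \notin mu
             & edge e.1 e.2]].

Record micro_tree_cover (B : nat) (C : {set {set T}}) : Prop := MicroTreeCover {
  mtc_connected : forall mu, mu \in C -> connected_nodes mu;
  mtc_cover : cover C = [set: T];
  mtc_share : forall mu nu, mu \in C -> nu \in C -> mu != nu ->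
    [disjoint mu & nu] \/
    (micro_root mu = micro_root nu /\ mu :&: nu = [set micro_root mu]);
  mtc_size : forall mu, mu \in C -> #|mu| < 2 * B;
  mtc_leaving : forall mu, mu \in C -> #|leaving_edges mu| <= 1 }.

Definition child_micro_tree (nu mu : {set T}) : bool :=
  [exists p in mu, childrel p (micro_root nu)].

Definition child_micro_trees (C : {set {set T}}) (mu : {set T}) :
    {set {set T}} :=
  [set nu in C | child_micro_tree nu mu].

End Trees.

(* [m] is at most [c] times [max (n / B, 1)].  The maximum with 1 only matters
   when [n < B]: a nonempty tree has at least one micro tree, so a bound
   [c * (n / B)] cannot hold uniformly there; for [B <= n] this is literally
   [m <= c * (n / B)] with the exact quotient. *)
Definition bounded_by_n_over_B (c m n B : nat) : Prop := m * B <= c * maxn n B.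

(* An algorithm taking a tree and a parameter to a collection of sets of nodes,
   given by its input-output relation: [FM T t B C] means that it produces [C]
   from [t] with parameter [B]. *)
Definition tree_covering_algorithm :=
  forall T : finType, tree T -> nat -> {set {set T}} -> Prop.

(* The guarantees of the Farzan-Munro algorithm; the constant hidden in the
   O(n/B) is the same for all trees and all parameters. *)
Definition farzan_munro (FM : tree_covering_algorithm) : Prop :=
  exists c : nat, forall (T : finType) (t : tree T) (B : nat) (C : {set {set T}}),
    ordinal_tree t -> 1 <= B -> FM T t B C ->
    micro_tree_cover t B C /\ bounded_by_n_over_B c #|C| #|T| B.

Section ModifiedTree.
Variables (T : finType) (t : tree T) (C : {set {set T}}).

(* One dummy node for each micro tree with more than one node. *)
Definition dummy := {mu : {set T} | (mu \in C) && (1 < #|mu|)}.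

(* [inl v] is the node [v] of the original tree, [inr d] the dummy node created
   for the micro tree [val d]. *)
Definition modified_node : finType := (T + dummy)%type.

(* What the child [c] of [v] turns into in the list of children of [v]. *)
Definition replace_child (v c : T) : modified_node :=
  if [pick d : dummy | (micro_root t (val d) == v) && (c \in val d)] is Some d
  then inr d else inl c.

(* The dummy node of [mu] takes, among the children of the root of [mu], the
   position of the first child that it adopts ([undup] keeps last occurrences,
   so reversing the list before and after it keeps the first ones);
   [modified_tree_ordinal] below shows that the result is an ordinal tree. *)
Definition modified_children (x : modified_node) : seq modified_node :=
  match x with
  | inl v => rev (undup (rev [seq replace_child v c | c <- children t v]))
  | inr d => [seq inl c | c <- children t (micro_root t (val d)) & c \in val d]
  end.

Definition modified_tree : tree modified_node :=
  Tree (inl (root t)) modified_children.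

Definition modified_cover : {set {set modified_node}} :=
  [set [set (inl v : modified_node) | v in mu] | mu : {set T} in C & #|mu| == 1]
  :|: [set [set (inl (micro_root t (val d)) : modified_node)] | d : dummy]
  :|: [set (inr d : modified_node)
             |: [set inl v | v in val d :\ micro_root t (val d)] | d : dummy].

End ModifiedTree.

Section WellFormed.
Variables (T : finType) (t : tree T).
Hypothesis tP : ordinal_tree t.
Local Notation anc := (connect (childrel t)).

Lemma anc_parent u v w : childrel t u w -> anc v w -> v != w -> anc v u.
Proof.
move=> uw /connectP[r]; case/lastP: r => [_ /= ->|r z]; first by rewrite eqxx.
rewrite rcons_path last_rcons => /andP[pr lz] wE _; subst w.
by rewrite (ot_parent tP uw lz); apply/connectP; exists r.
Qed.

Lemma child_not_anc u v : childrel t u v -> ~~ anc v u.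
Proof.
move=> uv; apply/negP => vu.
suff back x : anc x v -> anc v x.
  have /connectP[p] := back _ (ot_reach tP v).
  case/lastP: p => [_ /= rE|p z].
    by have := ot_root tP u; rewrite rE (uv : v \in _).
  rewrite rcons_path last_rcons => /andP[_ lz] zE; subst z.
  by have := ot_root tP (last v p); rewrite (lz : root t \in _).
case/connectP=> p; elim: p x => [|y p IH] x /=; first by move=> _ ->.
case/andP=> xy pp lp; have vy := IH y pp lp.
have [yv|nyv] := eqVneq v y; last exact: anc_parent xy vy nyv.
by rewrite (ot_parent tP (xy : y \in children t x) (_ : y \in children t u)) // -yv.
Qed.

Lemma anc_antisym x y : anc x y -> anc y x -> x = y.
Proof.
move=> /connectP[[|z p] /=]; first by move=> _ ->.
case/andP=> xz pp lp yx; have := child_not_anc xz.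
by rewrite (connect_trans _ yx) //; apply/connectP; exists p.
Qed.

Lemma micro_rootP mu : connected_nodes t mu ->
  micro_root t mu \in mu /\
  {in mu, forall x, connect (childrel t) (micro_root t mu) x}.
Proof.
case=> /set0Pn[x0 x0mu] conn; rewrite /micro_root.
case: pickP => [r /andP[rmu /forall_inP rP] //|noroot].
have [r rmu rmax] := @arg_maxnP _ x0 (mem mu) (fun x => #|anc x|) x0mu.
move: (noroot r); rewrite (rmu : r \in mu) /= => /negbT/negP[]; apply/forall_inP => x xmu.
have /connectP[p] := conn _ _ rmu xmu.
have : anc r r by [].
elim: p {2 3 4}r => [|b p IH] a ra /=; first by move=> _ ->.
case/andP=> /and3P[amu bmu ab] pp lp; apply: (IH b) => //.
case/orP: ab => [ab|ba]; first exact: connect_trans ra (connect1 ab).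
have [aE|nar] := eqVneq r a; last exact: anc_parent ba ra nar.
subst a; have /negP[] := child_not_anc ba.
have sub : anc r \subset anc b.
  apply/subsetP => z; rewrite !inE; exact: connect_trans (connect1 ba).
have cE : #|anc r| == #|anc b| by rewrite eqn_leq subset_leq_card //=; apply: rmax.
have := cE; rewrite (subset_leqif_card sub) => /subsetP/(_ b); rewrite !inE.
by apply; exact: connect0.
Qed.

Lemma micro_root_child mu : connected_nodes t mu -> 1 < #|mu| ->
  exists2 c, c \in mu & c \in children t (micro_root t mu).
Proof.
move=> cmu; have [rmu rP] := micro_rootP cmu.
rewrite (cardsD1 (micro_root t mu)) rmu ltnS => /card_gt0P[x].
rewrite !inE => /andP[xr xmu]; case: cmu => _ /(_ _ _ rmu xmu)/connectP[[|y p] /=].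
  by move=> _ xE; rewrite xE eqxx in xr.
case/andP=> /and3P[_ ymu /orP[ry|yr]] _ _; first by exists y.
by have := child_not_anc yr; rewrite rP.
Qed.

Variables (B : nat) (C : {set {set T}}).
Hypothesis CP : micro_tree_cover t B C.
Local Notation D := (dummy C).

Lemma dummy_uniq (d e : D) c : c \in val d -> c \in val e ->
  c != micro_root t (val d) -> d = e.
Proof.
move=> cd ce cr; apply/eqP; rewrite -val_eqE; apply/negPn/negP => de.
have /andP[dC _] := valP d; have /andP[eC _] := valP e.
have [/pred0P/(_ c)|[_ /setP/(_ c)]] := mtc_share CP dC eC de.
  by rewrite /= cd ce.
by rewrite !inE cd ce (negPf cr).
Qed.

Lemma childNroot v c : c \in children t v -> c != v.
Proof.
by move=> cv; apply/eqP => cE; have := child_not_anc cv; rewrite cE connect0.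
Qed.

Lemma replace_childP (d : D) v c : c \in children t v ->
  (replace_child t C v c == inr d) =
  (micro_root t (val d) == v) && (c \in val d).
Proof.
move=> cv; rewrite /replace_child; case: pickP => [e /andP[/eqP ev ce]|/(_ d) ->//].
apply/eqP/andP => [[<-]|[/eqP dv cd]]; first by rewrite ev eqxx.
by congr inr; apply: dummy_uniq ce cd _; rewrite ev childNroot.
Qed.

Lemma replace_child_inl v c w : replace_child t C v c = inl w -> w = c.
Proof. by rewrite /replace_child; case: pickP => [//|_ [->]]. Qed.

Lemma mem_modified_children v (x : modified_node C) :
  (x \in modified_children t (inl v)) =
  (x \in [seq replace_child t C v c | c <- children t v]).
Proof. by rewrite /= mem_rev mem_undup mem_rev. Qed.

Lemma dummy_child (d : D) :
  inr d \in modified_children (C := C) t (inl (micro_root t (val d))).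
Proof.
have /andP[dC d1] := valP d; rewrite mem_modified_children.
have [c cd cr] := micro_root_child (mtc_connected CP dC) d1.
by apply/mapP; exists c => //; apply/esym/eqP; rewrite replace_childP ?eqxx.
Qed.

Lemma modified_tree_ordinal : ordinal_tree (modified_tree t C).
Proof.
split=> /=.
- case=> [v|d] /=; first by rewrite rev_uniq undup_uniq.
  by rewrite map_inj_uniq ?filter_uniq ?(ot_uniq tP) // => x y [].
- case=> [v|d] /=.
    rewrite mem_modified_children; apply/mapP => -[c cv /esym/replace_child_inl rc].
    by have := ot_root tP v; rewrite rc cv.
  apply/mapP => -[c]; rewrite mem_filter => /andP[_ cv] [rc].
  by have := ot_root tP (micro_root t (val d)); rewrite rc cv.
- have inlP v c : inl c \in modified_children (C := C) t (inl v) ->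
      c \in children t v /\ replace_child t C v c = inl c.
    rewrite mem_modified_children => /mapP[w wv /esym E].
    by have cE := replace_child_inl E; subst w.
  have inrP v d : inr d \in modified_children (C := C) t (inl v) -> micro_root t (val d) = v.
    rewrite mem_modified_children => /mapP[w wv /esym/eqP].
    by rewrite replace_childP // => /andP[/eqP].
  have dP d c : inl c \in modified_children (C := C) t (inr d) ->
      c \in children t (micro_root t (val d)) /\ c \in val d.
    by case/mapP=> w; rewrite mem_filter => /andP[wd wr] [->].
  have mixP v d c : inl c \in modified_children (C := C) t (inl v) ->
      inl c \in modified_children (C := C) t (inr d) -> False.
    move=> /inlP[cv E] /dP[cr cd]; have := ot_parent tP cv cr => vE.
    by have := replace_childP d cv; rewrite E vE eqxx cd => /esym.
  case=> [u|d] [v|e] [c|f].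
  + by move=> /inlP[cu _] /inlP[cv _]; rewrite (ot_parent tP cu cv).
  + by move=> /inrP <- /inrP <-.
  + by move=> cu /(mixP _ _ _ cu).
  + by move=> _ /mapP[].
  + by move=> cd /mixP/(_ cd).
  + by move=> /mapP[].
  + move=> /dP[cd cid] /dP[ce cie]; congr inr; apply: dummy_uniq cid cie _.
    exact: childNroot.
  + by move=> /mapP[].
- have inlP v : connect (childrel (modified_tree t C)) (inl (root t)) (inl v).
    have /connectP[p] := ot_reach tP v.
    elim/last_ind: p v => [|p y IH] v /=; first by move=> _ ->.
    rewrite rcons_path last_rcons => /andP[pp lv] ->.
    apply: connect_trans (IH _ pp erefl) _.
    set u := last _ _ in lv *; case E: (replace_child t C u y) => [w|d].
      apply: connect1; rewrite /childrel /= mem_modified_children.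
      by apply/mapP; exists y; rewrite // E (replace_child_inl E).
    move/eqP: (E); rewrite replace_childP // => /andP[/eqP ru yd].
    apply: (connect_trans (y := inr d)); apply: connect1; rewrite /childrel /=.
      by have := dummy_child d; rewrite ru.
    by apply/mapP; exists y; rewrite // mem_filter yd ru.
  case=> [v|d]; first exact: inlP.
  apply: connect_trans (inlP (micro_root t (val d))) (connect1 _).
  exact: dummy_child.
Qed.
End WellFormed.

(* Main.v *)
(* In a micro tree [mu] with root [v], at most one edge leaves [mu] from a node
   other than [v]. Splitting off [v] as a singleton leaves that edge only: the
   children of the dummy node [w] lie in [mu], and a micro tree rooted at one of
   them would share a node other than [v] with [mu]. So a child micro tree of
   [w |: (mu :\ v)] is [{c}] for an edge of [t] from a non-root node of [mu] to
   a node [c] outside [mu]. *)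
Require Import Defs.
From mathcomp Require Import all_boot.

Set Implicit Arguments.
Unset Strict Implicit.
Unset Printing Implicit Defensive.

Lemma connect_invariant (T : finType) (e : rel T) (P : T -> Prop) x y :
  (forall a b, P a -> e a b -> P b) -> connect e x y -> P x -> P y.
Proof.
move=> step /connectP[p]; elim: p x => [|z p IH] x /=; first by move=> _ ->.
by case/andP=> xz pp lp Px; apply: (IH z) => //; apply: step xz.
Qed.

Section OrdinalTree.
Variables (T : finType) (t : tree T).
Hypothesis tP : ordinal_tree t.

Lemma micro_root_eq (mu : {set T}) r : r \in mu ->
  {in mu, forall x, connect (childrel t) r x} -> micro_root t mu = r.
Proof.
move=> rmu rP; rewrite /micro_root; case: pickP => [s|/(_ r)].
  by case/andP=> smu /forall_inP sP; apply: (anc_antisym tP); [apply: sP|apply: rP].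
by rewrite rmu /= => /negbT/negP[]; apply/forall_inP.
Qed.

Lemma micro_root1 (r : T) : micro_root t [set r] = r.
Proof. by apply: micro_root_eq => [|x]; rewrite !inE // => /eqP ->. Qed.

Lemma child_neq_micro_root mu u c : connected_nodes t mu -> u \in mu ->
  c \in children t u -> c != micro_root t mu.
Proof.
move=> cmu umu uc; have [_ rP] := micro_rootP tP cmu.
by apply/eqP => cE; have := child_not_anc tP uc; rewrite cE rP.
Qed.

(** Connectedness of [mu] allows edges in both directions. Unique parents make every upward step
    retrace the last downward one, so downward paths inside [mu] suffice. This form lets paths be
    transported to the modified tree. *)
Lemma micro_root_connect_in mu x : connected_nodes t mu -> x \in mu ->
  connect [rel a b | [&& a \in mu, b \in mu & childrel t a b]]
          (micro_root t mu) x.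
Proof.
move=> cmu xmu; have [rmu _] := micro_rootP tP cmu.
have [_ /(_ _ _ rmu xmu) conn] := cmu.
set r := micro_root t mu in rmu conn *.
pose P z : Prop :=
  connect [rel a b | [&& a \in mu, b \in mu & childrel t a b]] r z.
apply: (@connect_invariant _ _ P _ _ _ conn); rewrite /P // => a b ra.
case/and3P=> amu bmu /orP[ab|ba].
  by apply: connect_trans ra (connect1 _); rewrite /= amu bmu.
(* Upward step from [a] to its parent [b]: since [b] is in [mu], [a] is not the root, so the path to
   [a] has a last edge. That edge comes from [b], and dropping it leaves a path to [b]. *)
case/connectP: ra => p; case/lastP: p => [_ /= aE|p z].
  by have := child_neq_micro_root cmu bmu ba; rewrite aE eqxx.
rewrite rcons_path last_rcons => /andP[pp /and3P[_ _ lz]] aE; subst z.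
by rewrite (ot_parent tP ba lz); apply/connectP; exists p.
Qed.

End OrdinalTree.

Section ModifiedCover.
Variables (T : finType) (t : tree T) (B : nat) (C : {set {set T}}).
Hypothesis tP : ordinal_tree t.
Hypothesis CP : micro_tree_cover t B C.

Let t'P : ordinal_tree (modified_tree t C).
Proof. exact: (modified_tree_ordinal tP CP). Qed.

Definition dummy_micro_tree (d : dummy C) : {set modified_node C} :=
  inr d |: [set inl v | v in val d :\ micro_root t (val d)].

Lemma dummy_connected (d : dummy C) : connected_nodes t (val d).
Proof. by have /andP[dC _] := valP d; exact: (mtc_connected CP dC). Qed.

Lemma mem_dummy_micro_tree_inl (d : dummy C) v :
  (inl v \in dummy_micro_tree d) = (v \in val d :\ micro_root t (val d)).
Proof. by rewrite !inE /= mem_imset ?inE // => x y []. Qed.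

Lemma mem_dummy_micro_tree_inr (d e : dummy C) :
  (inr e \in dummy_micro_tree d) = (e == d).
Proof.
rewrite in_setU1; apply/orP/eqP => [[/eqP[]|/imsetP[]]//|->].
by left.
Qed.

Lemma inl_modified_childrenP v c :
  reflect (c \in children t v /\ replace_child t C v c = inl c)
          (inl c \in modified_children (C := C) t (inl v)).
Proof.
rewrite mem_modified_children; apply: (iffP mapP) => [[w wv /esym E]|[cv E]].
  by have wE := replace_child_inl E; subst w.
by exists c.
Qed.

Lemma inr_modified_children v (d : dummy C) :
  inr d \in modified_children t (inl v) -> micro_root t (val d) = v.
Proof.
rewrite mem_modified_children => /mapP[w wv /esym/eqP].
by rewrite (replace_childP tP CP) // => /andP[/eqP].
Qed.

(** A downward path inside [val d] from its root survives in the modified tree, except that its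
    first edge now starts at the dummy node. *)
Lemma micro_root_dummy_micro_tree (d : dummy C) :
  micro_root (modified_tree t C) (dummy_micro_tree d) = inr d.
Proof.
have cd := dummy_connected d; set r := micro_root t (val d).
apply: (micro_root_eq t'P) => [|[v|e]]; rewrite ?mem_dummy_micro_tree_inr //; last first.
  by move/eqP=> ->.
rewrite mem_dummy_micro_tree_inl !inE -/r => /andP[vr vd].
(* The old root [r] is not below the dummy node, so the invariant along the path has to except
   it. *)
pose P u := u = r \/ connect (childrel (modified_tree t C)) (inr d) (inl u).
suff: P v by case=> // vE; rewrite vE eqxx in vr.
apply: (@connect_invariant _ _ P _ _ _ (micro_root_connect_in tP cd vd)); last by left.
move=> a b aP /and3P[ad bd ab]; right.
have br := child_neq_micro_root tP cd ad ab.
case: aP => [aE|da].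
  by apply: connect1; apply/mapP; exists b; rewrite // mem_filter bd -/r -aE.
have [aE|ar] := eqVneq a r.
  by apply: connect1; apply/mapP; exists b; rewrite // mem_filter bd -/r -aE.
apply: connect_trans da (connect1 _); apply/inl_modified_childrenP; split=> //.
(* The edge from [a] to [b] is lost only if the dummy node of some [e] rooted at [a] adopts [b].
   Then [d] and [e] share the non-root node [b], so they coincide and [a] is [r], which is
   excluded. *)
case E: (replace_child t C a b) => [w|e].
  by rewrite (replace_child_inl E).
move/eqP: E; rewrite (replace_childP tP CP) // => /andP[/eqP ra be].
by have de := dummy_uniq CP bd be br; rewrite -ra -de /r eqxx in ar.
Qed.

(** Kept singletons and split-off roots are treated alike: all that matters later is that the node
    is the root of some member of [C]. *)
Lemma modified_coverP (nu : {set modified_node C}) : nu \in modified_cover t C ->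
  (exists mu c, [/\ mu \in C, micro_root t mu = c, c \in mu & nu = [set inl c]])
  \/ exists d, nu = dummy_micro_tree d.
Proof.
case/setUP=> [/setUP[]|/imsetP[d _ ->]]; last by right; exists d.
- case/imsetP=> mu /setIdP[muC /cards1P[c muE]] ->; left; exists mu, c.
  by rewrite muE micro_root1 // imset_set1 set11 -muE.
- case/imsetP=> d _ ->; left; exists (val d), (micro_root t (val d)).
  have /andP[dC _] := valP d.
  by have [rd _] := micro_rootP tP (dummy_connected d).
Qed.

(** Distinct micro trees that meet have the same root. *)
Lemma micro_root_in_micro_tree (d : dummy C) mu : mu \in C ->
  micro_root t mu \in mu -> micro_root t mu \in val d ->
  micro_root t mu = micro_root t (val d).
Proof.
move=> muC rmu rd; have /andP[dC _] := valP d.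
have [->//|neq] := eqVneq mu (val d).
have [/pred0P/(_ (micro_root t mu))|[]//] := mtc_share CP muC dC neq.
by rewrite /= rmu rd.
Qed.

Lemma child_dummy_micro_tree (d : dummy C) nu :
  nu \in child_micro_trees (modified_tree t C) (modified_cover t C)
           (dummy_micro_tree d) ->
  exists2 e, e \in leaving_edges t (val d) & nu = [set inl e.2].
Proof.
have cd := dummy_connected d.
case/setIdP=> /modified_coverP[[mu [c [muC muc cmu ->]]]|[e ->]].
  (* If [c] were in [val d], then, being the root of [mu], it would also be the root of [val d],
     although its parent [u] lies in [val d]. *)
  have c_notin u : u \in val d -> c \in children t u -> c \notin val d.
    move=> ud uc; apply/negP => cind; subst c.
    by have := child_neq_micro_root tP cd ud uc;
      rewrite (micro_root_in_micro_tree muC cmu cind) eqxx.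
  rewrite /child_micro_tree (micro_root1 t'P) => /exists_inP[[x|e]].
    rewrite mem_dummy_micro_tree_inl !inE => /andP[xr xd].
    case/inl_modified_childrenP=> xc _; exists (x, c) => //.
    by rewrite inE /= xd xr (c_notin _ xd xc); apply/orP; left.
  rewrite mem_dummy_micro_tree_inr => /eqP -> /mapP[w].
  rewrite mem_filter => /andP[wd wr] [cE]; subst w.
  by have [rd _] := micro_rootP tP cd; have := c_notin _ rd wr; rewrite wd.
(* A dummy node hangs below the root of its own micro tree [val e]; if that root lies in [val d], it
   is the root of [val d], which has been split off. *)
rewrite /child_micro_tree micro_root_dummy_micro_tree => /exists_inP[[x|f] xd].
  move/inr_modified_children=> ex; move: xd.
  rewrite mem_dummy_micro_tree_inl !inE -ex => /andP[/eqP xr xd]; case: xr.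
  have /andP[eC _] := valP e; apply: micro_root_in_micro_tree => //.
  by have [] := micro_rootP tP (dummy_connected e).
by case/mapP.
Qed.

Lemma card_child_dummy_micro_tree (d : dummy C) :
  #|child_micro_trees (modified_tree t C) (modified_cover t C)
      (dummy_micro_tree d)| <= 1.
Proof.
have /andP[dC _] := valP d; apply: leq_trans (mtc_leaving CP dC).
apply: leq_trans (leq_imset_card (fun e => [set inl e.2 : modified_node C]) _).
apply/subset_leq_card/subsetP => nu /child_dummy_micro_tree[e le ->].
exact: imset_f.
Qed.

Lemma card_dummy_micro_tree (d : dummy C) : #|dummy_micro_tree d| = #|val d|.
Proof.
have [rd _] := micro_rootP tP (dummy_connected d).
rewrite cardsU1 card_imset => [|x y [//]].
by rewrite (cardsD1 (micro_root t (val d)) (val d)) rd; case: imsetP => // -[].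
Qed.

(** Each micro tree of [C] gives at most one set in each of the three families forming the cover. *)
Lemma card_modified_cover : #|modified_cover t C| <= 3 * #|C|.
Proof.
have dC : #|{: dummy C}| <= #|C|.
  by rewrite card_sig; apply/subset_leq_card/subsetP => mu /andP[].
have leU (X Y : {set {set modified_node C}}) : #|X :|: Y| <= #|X| + #|Y|.
  by rewrite cardsU leq_subr.
rewrite !mulSn mul0n addn0 addnA.
apply: leq_trans (leU _ _) (leq_add _ (leq_trans (leq_imset_card _ _) dC)).
apply: leq_trans (leU _ _) (leq_add _ (leq_trans (leq_imset_card _ _) dC)).
apply: leq_trans (leq_imset_card _ _) (subset_leq_card _).
by apply/subsetP => mu /setIdP[].
Qed.
End ModifiedCover.

Theorem theorem7 (FM : tree_covering_algorithm) :
  farzan_munro FM ->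
  exists c' : nat,
  forall (T : finType) (t : tree T) (B : nat) (C : {set {set T}}),
    ordinal_tree t -> 1 <= B -> FM T t B C ->
    bounded_by_n_over_B c' #|modified_cover t C| #|T| B
    /\ forall mu, mu \in modified_cover t C ->
       #|mu| = 1
       \/ (#|mu| < 2 * B
           /\ #|child_micro_trees (modified_tree t C) (modified_cover t C) mu|
              <= 1).
Proof.
case=> c cP; exists (3 * c) => T t B C tP B1 fm.
have [CP Cn] := cP T t B C tP B1 fm; split.
  rewrite /bounded_by_n_over_B -mulnA.
  apply: leq_trans (leq_mul (card_modified_cover t C) (leqnn B)) _.
  by rewrite -mulnA leq_mul2l.
move=> mu /(modified_coverP tP CP)[[nu [v [_ _ _ ->]]]|[d ->]].
  by left; rewrite cards1.
right; rewrite (card_dummy_micro_tree tP CP); split.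
  by have /andP[dC _] := valP d; exact: (mtc_size CP dC).
exact: (card_child_dummy_micro_tree tP CP).
Qed.
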